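(* Let $K$ be an algebraically closed field, let $R=K[x_1,\dots,x_N]$ be a polynomial ring over $K$, let $n\ge 3$, and let $X$ be a $(2\times n)$-matrix whose entries are linear forms of $R$ that are linearly dependent over $K$. Then \[ \operatorname{ara} I_2(X)\le 2n-4 . \]
   Context: $I_2(X)$ denotes the ideal of $R$ generated by all $2$-minors of $X$. For an ideal $I$ of a Noetherian ring $S$, the arithmetical rank $\operatorname{ara} I$ is the minimum number $r$ of elements $f_1,\dots,f_r\in S$ such that $\sqrt{I}=\sqrt{(f_1,\dots,f_r)}$. A linear form is a $K$-linear combination of $x_1,\dots,x_N$ (possibly zero). The $2n$ entries are considered as a family indexed by their positions; linear dependence means that a nontrivial $K$-linear combination of this family is zero. *)

(* Defs.v *)
From HB Require Import structures.
From mathcomp Require Import all_boot all_order all_algebra.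
From mathcomp Require Import mpoly.

Set Implicit Arguments.
Unset Strict Implicit.
Unset Printing Implicit Defensive.

Import GRing.Theory.

Local Open Scope ring_scope.

Section Ideals.

Variable R : comNzRingType.

(* Subsets and ideals of R are Prop-valued predicates, since membership in an
   ideal generated by arbitrary elements need not be decidable. *)
Definition ideal_gen (S : R -> Prop) (p : R) : Prop :=
  exists (k : nat) (a s : 'I_k -> R),
    (forall i, S (s i)) /\ p = \sum_(i < k) a i * s i.

Definition radical (I : R -> Prop) (p : R) : Prop :=
  exists k : nat, I (p ^+ k).

Definition radically_gen_by (I : R -> Prop) (r : nat) : Prop :=
  exists f : 'I_r -> R,
    forall p : R,
      radical I p <-> radical (ideal_gen (fun q => exists i, q = f i)) p.

(* The arithmetical rank as a relation: "ara I = r".  Asserting it for some r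
   includes the existence of the minimum. *)
Definition is_ara (I : R -> Prop) (r : nat) : Prop :=
  radically_gen_by I r /\ forall s : nat, radically_gen_by I s -> (r <= s)%N.

Definition is_minor (t m n : nat) (X : 'M[R]_(m, n)) (p : R) : Prop :=
  exists (f : 'I_t -> 'I_m) (g : 'I_t -> 'I_n),
    [/\ forall i j : 'I_t, (i < j)%N -> (f i < f j)%N,
        forall i j : 'I_t, (i < j)%N -> (g i < g j)%N
      & p = \det (mxsub f g X)].

Definition minors_ideal (t m n : nat) (X : 'M[R]_(m, n)) : R -> Prop :=
  ideal_gen (is_minor t X).

End Ideals.

Definition linear_form (K : fieldType) (N : nat) (p : {mpoly K[N]}) : Prop :=
  exists c : 'I_N -> K, p = \sum_(i < N) c i *: 'X_i.

(* Dependence of the family of entries indexed by positions: a repeated entry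
   already makes the family dependent. *)
Definition entries_lin_dep (K : fieldType) (N m n : nat)
    (X : 'M[{mpoly K[N]}]_(m, n)) : Prop :=
  exists c : 'M[K]_(m, n),
    c != 0 /\ \sum_(i < m) \sum_(j < n) c i j *: X i j = 0.

(* Main.v *)
(** Normalise the linear relation among the entries to X_00 = 0 or X_00 + X_11 = 0
by invertible row and column operations, which preserve the ideal of 2-minors.  Up to
radical, that ideal is generated by the 2n-3 sums F_k of the minors [ij] with i + j = k.
The last of these sums is the single minor D = [n-2,n-1], and the others vanish exactly
where the rank is at most 1 or all entries outside the last two columns are zero.  If
the relation avoids the last two columns, replace X_00 by X_00 + D: where D is nonzero
the relation now forces a nonzero entry outside the last two columns, so D can be
dropped from the generators.  Only a 2x3 matrix with X_00 + X_11 = 0 remains, where the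
first two columns form a quadratic form whose value at the third column, together with
[01], generates the ideal up to radical. *)
Require Import Defs.
From HB Require Import structures.
From mathcomp Require Import all_boot all_order all_algebra.
From mathcomp Require Import mpoly ring zify.
From Stdlib Require Import Classical.

Set Implicit Arguments.
Unset Strict Implicit.
Unset Printing Implicit Defensive.

Import GRing.Theory.

Local Open Scope ring_scope.

(** * Ideals, radicals and the arithmetical rank *)

Section RadicalIdeals.

Variable R : comNzRingType.
Implicit Types (I S T Z : R -> Prop) (x y : R).

Definition ideal_pred I : Prop :=
  [/\ I 0, forall x y, I x -> I y -> I (x + y) & forall a x, I x -> I (a * x)].

(** A radical ideal; only square roots are asked for, and [radical_predX] extracts all others. *)
Definition radical_pred Z : Prop :=
  ideal_pred Z /\ forall x, Z (x ^+ 2) -> Z x.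

Lemma ideal_pred_sum I (J : Type) (r : seq J) (P : pred J) (F : J -> R) :
  ideal_pred I -> (forall i, P i -> I (F i)) -> I (\sum_(i <- r | P i) F i).
Proof. by case=> I0 ID _ IF; apply: big_ind. Qed.

Lemma ideal_predB I x y : ideal_pred I -> I x -> I y -> I (x - y).
Proof. by case=> _ ID IM Ix Iy; apply: ID => //; rewrite -mulN1r; apply: IM. Qed.

Lemma ideal_gen_sub S I :
  ideal_pred I -> (forall x, S x -> I x) -> forall x, ideal_gen S x -> I x.
Proof.
move=> idI SI x [k [a [s [Ss ->]]]]; apply: ideal_pred_sum => // i _.
by case: idI => _ _ IM; apply/IM/SI.
Qed.

Lemma ideal_gen_incl S x : S x -> ideal_gen S x.
Proof.
by move=> Sx; exists 1%N, (fun=> 1), (fun=> x); rewrite big_ord1 mul1r.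
Qed.

Lemma ideal_gen_ideal S : ideal_pred (ideal_gen S).
Proof.
split.
- by exists 0%N, (fun=> 0), (fun=> 0); split; [case | rewrite big_ord0].
- move=> x y [k [a [s [Ss ->]]]] [l [b [t [St ->]]]].
  exists (k + l)%N, (fun i => match split i with inl j => a j | inr j => b j end).
  exists (fun i => match split i with inl j => s j | inr j => t j end); split.
    by move=> i; case: (split i).
  rewrite big_split_ord /=; congr (_ + _); apply: eq_bigr => i _.
    by rewrite -/(unsplit (inl i)) unsplitK.
  by rewrite -/(unsplit (inr i)) unsplitK.
- move=> a x [k [b [s [Ss ->]]]]; exists k, (fun i => a * b i), s; split=> //.
  by rewrite mulr_sumr; apply: eq_bigr => i _; rewrite mulrA.
Qed.

Lemma radical_incl I x : I x -> radical I x.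
Proof. by exists 1%N. Qed.

Lemma radical_radical I : ideal_pred I -> radical_pred (radical I).
Proof.
move=> idI; have [I0 _ IM] := idI; split; first split.
- by exists 1%N.
- move=> x y [k Ik] [l Il]; exists (k + l)%N; rewrite exprDn.
  apply: ideal_pred_sum => // i _; rewrite -mulr_natl; apply: (IM).
  have [lei | lti] := leqP l i.
    by rewrite -(subnK lei) (exprD y) mulrA; apply: IM.
  have le_k : (k <= k + l - i)%N by lia.
  by rewrite -(subnK le_k) exprD mulrAC; apply: IM.
- by move=> a x [k Ik]; exists k; rewrite exprMn; apply: IM.
- by move=> x [k Ik]; exists (2 * k)%N; rewrite exprM.
Qed.

Lemma radical_predX Z x k : radical_pred Z -> Z (x ^+ k) -> Z x.
Proof.
move=> [[Z0 _ ZM] Zsqrt]; elim: k => [|k IHk] Zx.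
  by rewrite -[x]mulr1; apply: ZM; rewrite -(expr0 x).
case: k => [|k] in IHk Zx *; first by [].
(* The square of x^(k+1) is a multiple of x^(k+2), so the exponent drops by one. *)
apply/IHk/Zsqrt; rewrite -exprM.
by rewrite (_ : (k.+1 * 2 = k + k.+2)%N); [rewrite exprD; apply: ZM | lia].
Qed.

Lemma radical_sub S Z :
  radical_pred Z -> (forall x, S x -> Z x) ->
  forall x, radical (ideal_gen S) x -> Z x.
Proof.
move=> radZ SZ x [k Sxk]; apply: (@radical_predX _ _ k) => //.
by apply: ideal_gen_sub Sxk => //; case: radZ.
Qed.

Lemma radical_gen_eq S T :
    (forall x, S x -> radical (ideal_gen T) x) ->
    (forall x, T x -> radical (ideal_gen S) x) ->
  forall x, radical (ideal_gen S) x <-> radical (ideal_gen T) x.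
Proof.
by move=> ST TS x; split; apply: radical_sub => //; apply/radical_radical;
  apply: ideal_gen_ideal.
Qed.

(** Strong induction on r, with excluded middle deciding whether fewer generators suffice. *)
Lemma exists_ara (I : R -> Prop) r :
  radically_gen_by I r -> exists s, is_ara I s /\ (s <= r)%N.
Proof.
elim/ltn_ind: r => r IHr Ir.
have [[s [ltsr Is]] | min_r] :=
  classic (exists s, (s < r)%N /\ radically_gen_by I s).
  by have [t [ara_t le_ts]] := IHr s ltsr Is; exists t; split=> //; lia.
exists r; split=> //; split=> // s Is; rewrite leqNgt; apply/negP => ltsr.
by apply: min_r; exists s.
Qed.

End RadicalIdeals.

(** * Identities between the 2-minors *)

Section TwoMinors.

Variable R : comNzRingType.

Lemma det_2x2 (A : 'M[R]_2) : \det A = A 0 0 * A 1 1 - A 0 1 * A 1 0.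
Proof.
have l00 : lift ord0 ord0 = 1 :> 'I_2 by apply: val_inj.
have l10 : lift 1 ord0 = 0 :> 'I_2 by apply: val_inj.
rewrite (expand_det_row _ ord0) !big_ord_recl big_ord0 /cofactor !det_mx11 !mxE.
by rewrite !l00 l10 -[ord0]/(0 : 'I_2) /= addn0 expr0 expr1; ring.
Qed.

Definition minor2 n (X : 'M[R]_(2, n)) (i j : 'I_n) : R :=
  X 0 i * X 1 j - X 0 j * X 1 i.

Lemma is_minor2P n (X : 'M[R]_(2, n)) p :
  is_minor 2 X p <-> exists i j : 'I_n, (i < j)%N /\ p = minor2 X i j.
Proof.
split=> [[f [g [incf incg ->]]] | [i [j [ltij ->]]]].
  have lt01 : ((0%R : 'I_2) < (1%R : 'I_2))%N by [].
  exists (g 0), (g 1); split; first exact: incg.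
  have := incf _ _ lt01; have := ltn_ord (f 0%R); have := ltn_ord (f 1%R).
  move=> lt1 lt0 ltf; have f0 : f 0 = 0 by apply: val_inj => /=; lia.
  have f1 : f 1 = 1 by apply: val_inj => /=; lia.
  by rewrite det_2x2 !mxE f0 f1 /minor2.
exists id, (fun k : 'I_2 => if k == 0 then i else j); split=> //.
  by move=> k l; case: k => [[|[|k]] ltk]; case: l => [[|[|l]] ltl].
by rewrite det_2x2 !mxE /minor2.
Qed.

Lemma minor2_all n (X : 'M[R]_(2, n)) (I : R -> Prop) :
    ideal_pred I -> (forall i j : 'I_n, (i < j)%N -> I (minor2 X i j)) ->
  forall i j, I (minor2 X i j).
Proof.
move=> [I0 _ IM] Ilt i j; case: (ltngtP i j) => [|ltji|/val_inj ->].
- exact: Ilt.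
- rewrite (_ : minor2 X i j = -1 * minor2 X j i); first exact/IM/Ilt.
  by rewrite /minor2; ring.
- by rewrite /minor2 subrr.
Qed.

Lemma minors_ideal_minor2 n (X : 'M[R]_(2, n)) i j :
  minors_ideal 2 X (minor2 X i j).
Proof.
apply: minor2_all; first exact: ideal_gen_ideal.
move=> k l ltkl; apply: ideal_gen_incl; apply/is_minor2P.
by exists k, l.
Qed.

(** Taking Z to be the radical of (f) gives the nontrivial inclusion. Membership in Z plays the part
    of vanishing at a point. *)
Lemma radically_gen_minors n (X : 'M[R]_(2, n)) r (f : 'I_r -> R) :
    (forall q, minors_ideal 2 X (f q)) ->
    (forall Z, radical_pred Z -> (forall q, Z (f q)) ->
       forall i j : 'I_n, (i < j)%N -> Z (minor2 X i j)) ->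
  radically_gen_by (minors_ideal 2 X) r.
Proof.
move=> If Zf; exists f; apply: radical_gen_eq => x.
  case/is_minor2P=> i [j [ltij ->]]; apply: Zf => // [|q].
    exact/radical_radical/ideal_gen_ideal.
  by apply/radical_incl/ideal_gen_incl; exists q.
by case=> q ->; apply/radical_incl/If.
Qed.

(** Cauchy-Binet, with each minor of Q spread over the two orders of the pair (k, l). *)
Lemma minor2_mul m n (P : 'M[R]_2) (X : 'M[R]_(2, m)) (Q : 'M[R]_(m, n)) i j :
  minor2 (P *m X *m Q) i j =
  \det P * \sum_k \sum_l Q k i * Q l j * minor2 X k l.
Proof.
have minorP k l : minor2 (P *m X) k l = \det P * minor2 X k l.
  rewrite det_2x2 /minor2 !mxE !big_ord_recl !big_ord0.
  have -> : lift ord0 ord0 = 1 :> 'I_2 by apply: val_inj.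
  by rewrite -[ord0]/(0 : 'I_2); ring.
rewrite mulr_sumr; under eq_bigr => k _ do rewrite mulr_sumr.
under eq_bigr => k _ do under eq_bigr => l _ do rewrite mulrCA -minorP.
move: (P *m X) => Y; rewrite {1}/minor2 !mxE !big_distrlr /=.
rewrite [X in _ - X]exchange_big -sumrB; apply: eq_bigr => k _ /=.
rewrite -sumrB; apply: eq_bigr => l _; rewrite /minor2; ring.
Qed.

Lemma minors_ideal_mul m n (P : 'M[R]_2) (X : 'M[R]_(2, m)) (Q : 'M[R]_(m, n)) p :
  minors_ideal 2 (P *m X *m Q) p -> minors_ideal 2 X p.
Proof.
have idX := ideal_gen_ideal (is_minor 2 X); have [_ _ IM] := idX.
apply: ideal_gen_sub => // _ /is_minor2P[i [j [_ ->]]].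
rewrite minor2_mul; apply/IM; apply: ideal_pred_sum => // k _.
by apply: ideal_pred_sum => // l _; apply/IM/minors_ideal_minor2.
Qed.

Lemma minors_ideal_equiv n (P P' : 'M[R]_2) (X : 'M[R]_(2, n)) (Q Q' : 'M[R]_n) p :
    P' *m P = 1%:M -> Q *m Q' = 1%:M ->
  minors_ideal 2 (P *m X *m Q) p <-> minors_ideal 2 X p.
Proof.
move=> P'P QQ'; split; first exact: minors_ideal_mul.
have {1}-> : X = P' *m (P *m X *m Q) *m Q'.
  by rewrite !mulmxA P'P mul1mx -mulmxA QQ' mulmx1.
exact: minors_ideal_mul.
Qed.

(** The three-term Plücker relation. *)
Lemma minor2_plucker n (X : 'M[R]_(2, n)) i j k l :
  minor2 X i j * minor2 X k l =
  minor2 X j l * minor2 X i k - minor2 X j k * minor2 X i l.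
Proof. by rewrite /minor2; ring. Qed.

(** Expansion of the vanishing 3x3 determinant on columns i, j, k in which row r is repeated. *)
Lemma minor2_col n (X : 'M[R]_(2, n)) r i j k :
  minor2 X j k * X r i = X r j * minor2 X i k - X r k * minor2 X i j.
Proof.
rewrite /minor2; case: r => [[|[|r]] ltr] //.
  by have -> : Ordinal ltr = 0 by [apply: val_inj]; ring.
by have -> : Ordinal ltr = 1 by [apply: val_inj]; ring.
Qed.

(** * Generation up to radical by sums of minors *)

Definition minor2_sum n (X : 'M[R]_(2, n)) (k : nat) : R :=
  \sum_(p : 'I_n * 'I_n | (p.1 < p.2)%N && (p.1 + p.2 == k)%N)
    minor2 X p.1 p.2.

(* Two distinct minors [ij], [kl] with i < k < l < j and i + j = k + l satisfy
   [ij][kl] in ([ik], [il]), where [ik] and [il] belong to smaller sums. *)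
Lemma minor2_sum_elim n (X : 'M[R]_(2, n)) (Z : R -> Prop) N :
    radical_pred Z ->
    (forall k, (0 < k <= N)%N -> Z (minor2_sum X k)) ->
  forall i j : 'I_n, (i < j)%N -> (i + j <= N)%N -> Z (minor2 X i j).
Proof.
move=> [idZ Zsqrt] ZF i j ltij leijN; have [_ _ ZM] := idZ.
move ks: (i + j)%N => s; elim/ltn_ind: s => s IHs in i j ltij leijN ks *.
have prodZ (i1 j1 k l : 'I_n) : (i1 < k)%N -> (k < l)%N -> (i1 + j1 = s)%N ->
    (k + l = s)%N -> Z (minor2 X i1 j1 * minor2 X k l).
  move=> lti1k ltkl s1 s2; rewrite minor2_plucker; apply: ideal_predB => //.
    by apply/ZM/(IHs (i1 + k)%N) => //; lia.
  by apply/ZM/(IHs (i1 + l)%N) => //; lia.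
have ZFs : Z (minor2_sum X s) by apply: ZF; lia.
(* Multiplying the whole sum by one of its minors leaves the square of that minor, since the cross
   products lie in Z. *)
apply: Zsqrt; move: ZFs; rewrite /minor2_sum (bigD1 (i, j)) /=; last first.
  by rewrite ltij ks eqxx.
set rest := \sum_(p | _) _ => ZFs.
rewrite (_ : _ ^+ 2 = minor2 X i j * (minor2 X i j + rest) -
                      minor2 X i j * rest); last by ring.
apply: ideal_predB => //; first exact: ZM.
rewrite mulr_sumr; apply: ideal_pred_sum => // -[k l] /=.
case/andP=> /andP[ltkl /eqP skl] neq.
case: (ltngtP i k) => [ltik|ltki|/val_inj eik].
- exact: prodZ.
- by rewrite mulrC; apply: prodZ => //; lia.
- have ejl : j = l by apply: val_inj; move: (congr1 val eik) => /=; lia.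
  by rewrite eik ejl eqxx in neq.
Qed.

Lemma radically_gen_dep_outside_block n (X c : 'M[R]_(2, n)) r0 i0 :
    (3 <= n)%N -> \sum_r \sum_i c r i * X r i = 0 -> c r0 i0 = 1 ->
    (forall r (i : 'I_n), (n - 2 <= i)%N -> c r i = 0) ->
  radically_gen_by (minors_ideal 2 X) (2 * n - 4).
Proof.
move=> le3n depX c1 c0.
have lt_e : (n - 2 < n)%N by lia.
have lt_e' : (n - 1 < n)%N by lia.
pose e := Ordinal lt_e; pose e' := Ordinal lt_e'.
have lt_i0 : (i0 < n - 2)%N.
  by rewrite ltnNge; apply/negP => /(c0 r0) /eqP; rewrite c1 oner_eq0.
pose D := minor2 X e e'.
pose E : 'M[R]_(2, n) := delta_mx r0 i0.
(* Y agrees with X modulo D and has the same last minor, but the relation takes the value D on Y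
   instead of 0. *)
pose Y := X + D *: E.
have YE r k : Y r k = X r k + D * E r k by rewrite mxE [X in _ + X]mxE.
have minorY i j : exists a, minor2 Y i j = minor2 X i j + a * D.
  rewrite /minor2 !YE.
  exists (X 0 i * E 1 j + E 0 i * X 1 j + D * E 0 i * E 1 j
          - (X 0 j * E 1 i + E 0 j * X 1 i + D * E 0 j * E 1 i)).
  by ring.
have DY : minor2 Y e e' = D.
  have Ee r (i : 'I_n) : (n - 2 <= i)%N -> Y r i = X r i.
    move=> lei; rewrite !mxE (_ : i == i0 = false) ?andbF ?mulr0 ?addr0 //.
    by apply/eqP => ei; move: lei; rewrite ei; lia.
  by rewrite /minor2 !Ee //=; lia.
have depY : \sum_r \sum_i c r i * Y r i = D.
  have -> : \sum_r \sum_i c r i * Y r i =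
            \sum_r \sum_i c r i * X r i + \sum_r \sum_i c r i * (D * E r i).
    rewrite -big_split; apply: eq_bigr => r _ /=.
    by rewrite -big_split; apply: eq_bigr => i _; rewrite YE mulrDr.
  rewrite depX add0r (bigD1 r0) //= [X in _ + X]big1 => [|r ner]; last first.
    by apply: big1 => i _; rewrite mxE (negPf ner) !mulr0.
  rewrite (bigD1 i0) //= big1 => [|i nei].
    by rewrite mxE !eqxx c1 mul1r mulr1 !addr0.
  by rewrite mxE (negPf nei) andbF !mulr0.
(* The generators are the sums of index 1 to 2n-4: the sum of index 0 is empty and the one of index
   2n-3, equal to D, is dropped. *)
apply: (@radically_gen_minors _ _ _ (fun q : 'I__ => minor2_sum Y q.+1)).
  have idX := ideal_gen_ideal (is_minor 2 X).
  move=> q; apply: ideal_pred_sum => // -[i j] /= _.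
  have [_ ID IM] := idX; have [a ->] := minorY i j.
  by apply: ID; [| apply: IM]; apply: minors_ideal_minor2.
move=> Z radZ Zf.
have [idZ Zsqrt] := radZ; have [_ ZD ZM] := idZ.
have ZY (i j : 'I_n) : (i < j)%N -> (i + j <= 2 * n - 4)%N -> Z (minor2 Y i j).
  apply: minor2_sum_elim => // -[|k] // ltk.
  have ltk' : (k < 2 * n - 4)%N by lia.
  exact: (Zf (Ordinal ltk')).
(* Write D^2 as D times the relation on Y. For a column i < n-2, [minor2_col] expresses D * Y r i
   through the minors [i,n-2] and [i,n-1], whose index sums are at most 2n-4. *)
have ZD2 : Z D.
  apply: Zsqrt; rewrite expr2 -{2}depY mulr_sumr; apply: ideal_pred_sum => // r _.
  rewrite mulr_sumr; apply: ideal_pred_sum => // i _.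
  have [lei | lti] := leqP (n - 2) i; first by rewrite c0 // mul0r mulr0; case: idZ.
  rewrite mulrCA; apply: (ZM); rewrite -DY minor2_col.
  by apply: ideal_predB => //; apply/ZM/ZY => /=; lia.
move=> i j ltij; have [a minorYij] := minorY i j.
rewrite (_ : minor2 X i j = minor2 Y i j - a * D); last by rewrite minorYij addrK.
apply: ideal_predB => //; last exact: ZM.
have [leij | gtij] := leqP (i + j) (2 * n - 4); first exact: ZY.
have [ltin ltjn] := (ltn_ord i, ltn_ord j).
have -> : i = e by apply: val_inj => /=; lia.
have -> : j = e' by apply: val_inj => /=; lia.
by rewrite DY.
Qed.

(* For columns (x,y), (z,-x), (u,v), the quadratic form q = z v^2 + 2 x u v - y u^2 in
   (u,v) has discriminant a multiple of [01] = -(x^2 + y z): completing the square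
   gives [02]^2 = -y q and [12]^2 = z q modulo [01]. *)
Lemma radically_gen_traceless (X : 'M[R]_(2, 3)) :
  X 0 0 + X 1 1 = 0 -> radically_gen_by (minors_ideal 2 X) 2.
Proof.
move=> tr0; have X11 : X 1 1 = - X 0 0 by apply/eqP; rewrite -addr_eq0 addrC tr0.
pose q := X 1 2 * minor2 X 1 2 + X 0 2 * minor2 X 0 2.
apply: (@radically_gen_minors _ _ _
          (fun k : 'I_2 => if k == 0 then minor2 X 0 1 else q)) => [k|].
  have [_ ID IM] := ideal_gen_ideal (is_minor 2 X).
  case: eqP => _; first exact: minors_ideal_minor2.
  by apply: ID; apply: IM; apply: minors_ideal_minor2.
move=> Z [idZ Zsqrt] Zf; have [_ ZD ZM] := idZ.
have Z01 : Z (minor2 X 0 1) := Zf 0.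
have Zq : Z q := Zf 1.
have Z02 : Z (minor2 X 0 2).
  apply: Zsqrt; rewrite (_ : _ ^+ 2 = - X 1 0 * q + - X 1 2 ^+ 2 * minor2 X 0 1).
    by apply: ZD; apply: ZM.
  by rewrite /q /minor2 X11; ring.
have Z12 : Z (minor2 X 1 2).
  apply: Zsqrt; rewrite (_ : _ ^+ 2 = X 0 1 * q + - X 0 2 ^+ 2 * minor2 X 0 1).
    by apply: ZD; apply: ZM.
  by rewrite /q /minor2 X11; ring.
move=> i j; have [lti ltj] := (ltn_ord i, ltn_ord j).
case: i lti => -[|[|[|i]]] lti //= _; case: j ltj => -[|[|[|j]]] ltj //= _ _.
- by congr (Z (minor2 X _ _)): Z01; apply: val_inj.
- by congr (Z (minor2 X _ _)): Z02; apply: val_inj.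
- by congr (Z (minor2 X _ _)): Z12; apply: val_inj.
Qed.

End TwoMinors.

Theorem corollary5p1 (K : closedFieldType) (N n : nat) (hn : (3 <= n)%N)
    (X : 'M[{mpoly K[N]}]_(2, n))
    (hlin : forall (i : 'I_2) (j : 'I_n), linear_form (X i j))
    (hdep : entries_lin_dep X) :
  exists r : nat, is_ara (minors_ideal 2 X) r /\ (r <= 2 * n - 4)%N.
Proof.
apply: exists_ara; case: hdep => c [c_neq0 depX].
pose C m p := @map_mx _ _ (@mpolyC N K) m p.
have KC m (A : 'M[K]_m) : A \in unitmx -> C _ _ A *m C _ _ (invmx A) = 1%:M.
  by move=> uA; rewrite /C -map_mxM mulmxV // map_mx1.
have CK m (A : 'M[K]_m) : A \in unitmx -> C _ _ (invmx A) *m C _ _ A = 1%:M.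
  by move=> uA; rewrite /C -map_mxM mulVmx // map_mx1.
(* The relation reads tr(c^T X) = 0. Factoring c as [col_ebase c] times [pid_mx r] times
   [row_ebase c] and cycling the trace moves the transposed outer factors onto X. *)
pose L := (col_ebase c)^T; pose Q := (row_ebase c)^T.
have uL : L \in unitmx by rewrite unitmx_tr col_ebase_unit.
have uQ : Q \in unitmx by rewrite unitmx_tr row_ebase_unit.
pose Y := C _ _ L *m X *m C _ _ Q; pose r := \rank c.
have trE (A B : 'M[{mpoly K[N]}]_(2, n)) :
    \sum_i \sum_j A i j * B i j = \tr (A^T *m B).
  rewrite exchange_big; apply: eq_bigr => j _; rewrite mxE.
  by apply: eq_bigr => i _; rewrite mxE.
have depY : \sum_i \sum_j (pid_mx r : 'M_(2, n)) i j * Y i j = 0.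
  rewrite trE mulmxA mxtrace_mulC !mulmxA.
  have -> : C _ _ Q *m (pid_mx r : 'M_(2, n))^T *m C _ _ L = (C _ _ c)^T.
    rewrite -[in RHS](mulmx_ebase c) /C !map_mxM map_pid_mx !trmx_mul !map_trmx.
    by rewrite mulmxA.
  rewrite -trE -[RHS]depX.
  by do 2!(apply: eq_bigr => ? _); rewrite mxE mul_mpolyC.
have r_gt0 : (0 < r)%N by rewrite lt0n mxrank_eq0.
have r_le2 : (r <= 2)%N by apply: rank_leq_row.
suff [f Ef] : radically_gen_by (minors_ideal 2 Y) (2 * n - 4).
  have eqI p : minors_ideal 2 Y p <-> minors_ideal 2 X p.
    exact: minors_ideal_equiv (CK _ _ uL) (KC _ _ uQ).
  by exists f => p; rewrite -Ef; split=> -[k /eqI]; exists k.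
(* The new relation is the sum of the first r diagonal entries, so it avoids the last two columns
   exactly when r <= n-2. *)
have [le_r | gt_r] := leqP r (n - 2).
  have lt0n : (0 < n)%N by lia.
  apply: (radically_gen_dep_outside_block (r0 := 0) (i0 := Ordinal lt0n) _ depY).
  - by [].
  - by rewrite mxE /= r_gt0.
  - move=> i j le_j; rewrite mxE; case: andP => // -[/eqP eij ltir].
    by move: eij ltir => /= ->; lia.
have [n3 r2] : n = 3 /\ r = 2 by lia.
move: depY; rewrite r2; clearbody Y; move: Y; rewrite n3 => Y depY.
(* For n = 3 the bound 2n-4 is the 2 of the traceless case. *)
apply: radically_gen_traceless; rewrite -[RHS]depY.
rewrite !big_ord_recl !big_ord0 !mxE /= !mul1r !mul0r !addr0 !add0r.
by congr (Y _ _ + Y _ _); apply: val_inj.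
Qed.
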